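(* Let $n\ge 0$ and let $L=\partial^{n+1}+\sum_{i=0}^{n}a_i\partial^i\in\mathbb{Q}(z)[\partial]$ be irreducible, with dual operator $L^{\vee}$. Then $L$ satisfies property (P) if and only if $L$ is self-dual in the sense that there is an $0\neq\alpha\in\mathbb{C}(z)$ such that $L\alpha=\alpha L^{\vee}$ holds in $\mathbb{C}(z)[\partial]$. In particular, any such $\alpha$ satisfies $\alpha'=-\frac{2}{n+1}a_n\alpha$.
   Context: Here $\partial=\frac{d}{dz}$, and $\mathbb{C}(z)[\partial]$ is the ring of differential operators over $\mathbb{C}(z)$, with $\partial f=f\partial+f'$. In $L\alpha$ and $\alpha L^\vee$, the function $\alpha$ denotes the operator of multiplication by $\alpha$, and products are taken in $\mathbb{C}(z)[\partial]$. The dual of $L$ is $L^{\vee}:=\sum_{i=0}^{n+1}(-1)^{n+1+i}\partial^i a_i$ with $a_{n+1}:=1$. Let $M_L:=\mathbb{C}(z)[\partial]/\mathbb{C}(z)[\partial]L$ be the differential module of $L$ and let $e\in M_L$ be the class of $1$, so that $e,\partial e,\dots,\partial^n e$ is a $\mathbb{C}(z)$-basis of $M_L$. Property (P): there is a non-degenerate $\mathbb{C}(z)$-bilinear form $\langle\cdot,\cdot\rangle\colon M_L\times M_L\to\mathbb{C}(z)$ such that (1) the form is symmetric if $n$ is even and alternating if $n$ is odd, and it is compatible with the derivation: $\frac{d}{dz}\langle m_1,m_2\rangle=\langle\partial m_1,m_2\rangle+\langle m_1,\partial m_2\rangle$ for all $m_1,m_2\in M_L$; (2) $\langle e,\partial^i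 e\rangle=0$ for $i=0,\dots,n-1$. *)

(* Defs.v *)
From HB Require Import structures.
From mathcomp Require Import all_boot all_order all_algebra generic_quotient.
From mathcomp Require Import sesquilinear ring_quotient boolp.
From mathcomp Require Import reals complex ring.

Set Implicit Arguments.
Unset Strict Implicit.
Unset Printing Implicit Defensive.

Import Order.TTheory GRing.Theory Num.Theory.

Local Open Scope ring_scope.
Local Open Scope quotient_scope.

Reserved Notation "f %:O" (at level 1, format "f %:O").

HB.mixin Record Field_hasDerivation K of GRing.Field K := {
  der : K -> K;
  der_is_zmod_morphism : zmod_morphism der;
  derM : forall x y : K, der (x * y) = der x * y + x * der y
}.

#[short(type="diffFieldType")]
HB.structure Definition DiffField :=
  {K of GRing.Field K & Field_hasDerivation K}.

HB.instance Definition _ (K : diffFieldType) :=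
  GRing.isZmodMorphism.Build K K (@der K) (@der_is_zmod_morphism K).

Lemma der1 (K : diffFieldType) : der (1 : K) = 0.
Proof.
have := derM (1 : K) 1; rewrite !mulr1 mul1r => /eqP.
by rewrite -subr_eq0 opprD addNKr oppr_eq0 => /eqP.
Qed.

Definition ratfun (F : fieldType) := {fraction {poly F}}.
HB.instance Definition _ (F : fieldType) :=
  GRing.Field.copy (ratfun F) {fraction {poly F}}.

Section RationalFunctions.
Variable F : fieldType.
Local Notation "p %:F" := (@FracField.tofrac {poly F} p : ratfun F)
  (at level 1, format "p %:F").
Implicit Types (p q : {poly F}) (x y : ratfun F).

Lemma ratfun_repr x : x = (\n_(repr x))%:F / (\d_(repr x))%:F.
Proof.
set r := repr x; have dr := denom_ratioP r.
apply/(canRL (mulfK _)); first by rewrite tofrac_eq0.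
rewrite -[x]reprK -/r; unlock FracField.tofrac.
rewrite -[LHS]FracField.pi_mul; apply/eqmodP; rewrite /= /FracField.equivf.
by rewrite /FracField.mulf !numden_Ratio ?oner_eq0 ?mulr1 ?mulf_neq0 // mulrC.
Qed.

Lemma ratfunP x : exists p q, q != 0 /\ x = p%:F / q%:F.
Proof.
by exists \n_(repr x), \d_(repr x); rewrite -ratfun_repr denom_ratioP.
Qed.

Lemma eq_ratfun p q p' q' : q != 0 -> q' != 0 ->
  (p%:F / q%:F == p'%:F / q'%:F) = (p * q' == p' * q).
Proof.
move=> q0 q'0; rewrite eqr_div ?tofrac_eq0 //.
by rewrite -!tofracM tofrac_eq.
Qed.

(* The quotient rule, applied to the chosen representative of a fraction;
   ratfun_der_frac shows that the choice does not matter. *)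
Definition ratfun_der x : ratfun F :=
  let: n := \n_(repr x) in let: d := \d_(repr x) in
  (n^`() * d - n * d^`())%:F / (d ^+ 2)%:F.

Lemma ratfun_der_frac p q : q != 0 ->
  ratfun_der (p%:F / q%:F) = (p^`() * q - p * q^`())%:F / (q ^+ 2)%:F.
Proof.
move=> q0; rewrite /ratfun_der; set x := p%:F / q%:F.
have := ratfun_repr x; have := denom_ratioP (repr x).
move: (\n_(repr x)) (\d_(repr x)) => n d d0 /eqP.
rewrite eq_ratfun // => /eqP E; apply/eqP; rewrite eq_ratfun ?expf_neq0 //.
have E' : p^`() * d + p * d^`() - (n^`() * q + n * q^`()) = 0.
  by rewrite -!derivM E subrr.
have E0 : p * d - n * q = 0 by rewrite E subrr.
rewrite -subr_eq0; apply/eqP.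
transitivity ((d^`() * q + d * q^`()) * (p * d - n * q)
              - d * q * (p^`() * d + p * d^`() - (n^`() * q + n * q^`()))).
  by ring.
by rewrite E0 E' !mulr0 subrr.
Qed.

Lemma ratfun_der_is_zmod_morphism : zmod_morphism ratfun_der.
Proof.
move=> x y; have [p [q [q0 ->]]] := ratfunP x.
have [p' [q' [q'0 ->]]] := ratfunP y.
have -> : p%:F / q%:F - p'%:F / q'%:F
   = (p * q' - p' * q)%:F / (q * q')%:F :> ratfun F.
  rewrite -mulNr addf_div ?tofrac_eq0 // mulNr.
  by rewrite -!tofracM -tofracB.
rewrite !ratfun_der_frac ?mulf_neq0 //.
rewrite -[- (_ / _)]mulNr addf_div ?tofrac_eq0 ?expf_neq0 // mulNr.
rewrite -!tofracM -tofracB; apply/eqP.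
rewrite eq_ratfun ?mulf_neq0 ?expf_neq0 ?mulf_neq0 //.
by rewrite derivB !derivM; apply/eqP; ring.
Qed.

Lemma ratfun_derM x y :
  ratfun_der (x * y) = ratfun_der x * y + x * ratfun_der y.
Proof.
have [p [q [q0 ->]]] := ratfunP x; have [p' [q' [q'0 ->]]] := ratfunP y.
rewrite mulf_div -!tofracM !ratfun_der_frac ?mulf_neq0 // !mulf_div.
rewrite -!tofracM addf_div ?tofrac_eq0 ?mulf_neq0 ?expf_neq0 //.
rewrite -!tofracM -tofracD; apply/eqP.
rewrite eq_ratfun ?mulf_neq0 ?expf_neq0 ?mulf_neq0 //.
by rewrite !derivM; apply/eqP; ring.
Qed.

HB.instance Definition _ := Field_hasDerivation.Build (ratfun F)
  ratfun_der_is_zmod_morphism ratfun_derM.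

End RationalFunctions.

(* The inclusion F(z) -> E(z) induced by a field embedding iota : F -> E. *)
Section RationalFunctionsMap.
Variables (F E : fieldType) (iota : {rmorphism F -> E}).
Local Notation "p %:F" := (FracField.tofrac p).

Definition ratfun_map (x : ratfun F) : ratfun E :=
  (map_poly iota \n_(repr x))%:F / (map_poly iota \d_(repr x))%:F.

Lemma ratfun_map_frac (p q : {poly F}) : q != 0 ->
  ratfun_map (p%:F / q%:F) = (map_poly iota p)%:F / (map_poly iota q)%:F.
Proof.
move=> q0; rewrite /ratfun_map; set x : ratfun F := p%:F / q%:F.
have := ratfun_repr x; have := denom_ratioP (repr x).
move: (\n_(repr x)) (\d_(repr x)) => n d d0 /eqP.
rewrite eq_ratfun // => /eqP xE; apply/eqP.
by rewrite eq_ratfun ?map_poly_eq0 // -!rmorphM /= xE.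
Qed.

End RationalFunctionsMap.

(* The operator \sum_i a_i ∂^i (coefficients on the left) is stored as the
   polynomial \sum_i a_i 'X^i; the product is not that of {poly K}, but the
   one determined by ∂ f = f ∂ + f'. *)
Definition diffop (K : diffFieldType) := {poly K}.
HB.instance Definition _ (K : diffFieldType) :=
  GRing.Lmodule.copy (diffop K) {poly K}.

Section DifferentialOperators.
Variable K : diffFieldType.
Implicit Types (p q r : {poly K}) (P Q L : diffop K) (f g : K).

(* ∂ (\sum_i a_i ∂^i) = \sum_i a_i ∂^(i + 1) + \sum_i a_i' ∂^i. *)
Definition ddx_mul q : {poly K} := 'X * q + map_poly der q.

Definition diffop_mul p q : {poly K} :=
  \sum_(i < size p) p`_i *: iter i ddx_mul q.

Lemma ddx_mulB : zmod_morphism ddx_mul.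
Proof. by move=> p q; rewrite /ddx_mul raddfB mulrBr opprD addrACA. Qed.

HB.instance Definition _ :=
  GRing.isZmodMorphism.Build {poly K} {poly K} ddx_mul ddx_mulB.

Lemma ddx_mulZ f q : ddx_mul (f *: q) = der f *: q + f *: ddx_mul q.
Proof.
rewrite /ddx_mul -scalerAr scalerDr addrCA; congr (_ + _).
apply/polyP=> i; rewrite !(coefD, coefZ, coef_map_id0) ?raddf0 //.
exact: derM.
Qed.

Lemma iter_ddx_mulB i : zmod_morphism (iter i ddx_mul).
Proof. by elim: i => [|i IHi] p q //=; rewrite IHi raddfB. Qed.

Lemma diffop_mulE n p q : (size p <= n)%N ->
  diffop_mul p q = \sum_(i < n) p`_i *: iter i ddx_mul q.
Proof.
move=> pn; rewrite /diffop_mul (big_ord_widen n (fun i => p`_i *: iter i ddx_mul q)) //.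
rewrite big_mkcond; apply: eq_bigr => i _; case: ifPn => //.
by rewrite -leqNgt => ?; rewrite nth_default // scale0r.
Qed.

Lemma diffop_mulDl p q r :
  diffop_mul (p + q) r = diffop_mul p r + diffop_mul q r.
Proof.
have pq := size_polyD p q; have pm := leq_maxl (size p) (size q).
have qm := leq_maxr (size p) (size q).
rewrite (diffop_mulE _ pq) (diffop_mulE _ pm) (diffop_mulE _ qm) -big_split.
by apply: eq_bigr => i _; rewrite coefD scalerDl.
Qed.

Lemma diffop_mulBr p : zmod_morphism (diffop_mul p).
Proof.
move=> q r; rewrite -sumrB; apply: eq_bigr => i _.
by rewrite iter_ddx_mulB scalerBr.
Qed.

HB.instance Definition _ p :=
  GRing.isZmodMorphism.Build {poly K} {poly K} (diffop_mul p) (diffop_mulBr p).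

Lemma diffop_mul0l r : diffop_mul 0 r = 0.
Proof. by rewrite /diffop_mul size_poly0 big_ord0. Qed.

Lemma diffop_mul_suml I (s : seq I) (G : I -> {poly K}) r :
  diffop_mul (\sum_(i <- s) G i) r = \sum_(i <- s) diffop_mul (G i) r.
Proof.
by apply: (big_morph (diffop_mul^~ r)) => [p q|]; rewrite ?diffop_mulDl ?diffop_mul0l.
Qed.

Lemma diffop_mulZl f p q : diffop_mul (f *: p) q = f *: diffop_mul p q.
Proof.
rewrite (diffop_mulE _ (size_scale_leq f p)) scaler_sumr.
by apply: eq_bigr => i _; rewrite coefZ scalerA.
Qed.

Lemma diffop_mul_ddx p q : diffop_mul (ddx_mul p) q = ddx_mul (diffop_mul p q).
Proof.
rewrite diffop_mulDl raddf_sum /= (diffop_mulE _ (size_poly _ _)).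
have -> : diffop_mul ('X * p) q = \sum_(i < size p) p`_i *: iter i.+1 ddx_mul q.
  have sp : (size ('X * p)%R <= (size p).+1)%N.
    by rewrite (leq_trans (size_polyMleq _ _)) // size_polyX.
  rewrite (diffop_mulE _ sp) big_ord_recl coefXM scale0r add0r.
  by apply: eq_bigr => i _; rewrite coefXM.
rewrite -big_split; apply: eq_bigr => i _ /=.
by rewrite coef_map_id0 ?raddf0 // ddx_mulZ addrC.
Qed.

Lemma diffop_mulA : associative diffop_mul.
Proof.
move=> p q r; rewrite {2}/diffop_mul diffop_mul_suml.
apply: eq_bigr => i _; rewrite diffop_mulZl; congr (_ *: _).
by elim: (nat_of_ord i) => //= j ->; rewrite diffop_mul_ddx.
Qed.

Lemma iter_ddx_mul1 i : iter i ddx_mul 1 = 'X^i.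
Proof.
elim: i => [|i /= ->]; first by rewrite expr0.
rewrite /ddx_mul exprS -[RHS]addr0; congr (_ + _); apply/polyP=> j.
by rewrite coef_map_id0 ?raddf0 // coefXn coef0; case: eqP => _;
   rewrite ?der1 ?raddf0.
Qed.

Lemma diffop_mul1r : right_id 1 diffop_mul.
Proof.
move=> p; rewrite /diffop_mul -[RHS]coefK poly_def.
by apply: eq_bigr => i _; rewrite iter_ddx_mul1.
Qed.

Lemma diffop_mul1l : left_id 1 diffop_mul.
Proof.
by move=> q; rewrite /diffop_mul size_poly1 big_ord1 coef1 scale1r.
Qed.

Lemma diffop_mulDr : right_distributive diffop_mul +%R.
Proof. by move=> p q r; rewrite raddfD. Qed.

HB.instance Definition _ := GRing.Zmodule_isNzRing.Build (diffop K)
  diffop_mulA diffop_mul1l diffop_mul1r diffop_mulDl diffop_mulDr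
  (oner_neq0 {poly K}).

Definition ddx : diffop K := 'X.

Definition opC f : diffop K := f%:P.

Definition op_coef (P : diffop K) (i : nat) : K := (P : {poly K})`_i.

(* One more than the order of P, and 0 if P = 0. *)
Definition op_size (P : diffop K) : nat := size (P : {poly K}).

Lemma opC_is_zmod_morphism : zmod_morphism opC.
Proof. by move=> f g; rewrite /opC polyCB. Qed.

Lemma opC_mull f P : opC f * P = f *: P.
Proof.
rewrite [LHS]/GRing.mul /= /opC -[f%:P]alg_polyC diffop_mulZl.
by rewrite diffop_mul1l.
Qed.

Lemma opC_is_monoid_morphism : monoid_morphism opC.
Proof.
by split=> // f g; rewrite opC_mull /opC -[g%:P]alg_polyC scalerA alg_polyC.
Qed.

HB.instance Definition _ :=
  GRing.isZmodMorphism.Build K (diffop K) opC opC_is_zmod_morphism.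
HB.instance Definition _ :=
  GRing.isMonoidMorphism.Build K (diffop K) opC opC_is_monoid_morphism.

Lemma ddxM P : ddx * P = ddx_mul P.
Proof.
rewrite [LHS]/GRing.mul /= (diffop_mulE (n := 2)) ?size_polyX //.
by rewrite !big_ord_recl big_ord0 !coefX scale0r scale1r add0r addr0.
Qed.

Lemma ddx_opC f : ddx * opC f = opC f * ddx + opC (der f).
Proof.
rewrite ddxM opC_mull /ddx_mul /opC /ddx mulrC mul_polyC; congr (_ + _).
exact: map_polyC.
Qed.

Lemma op_coef_ddxXn (i j : nat) : op_coef (ddx ^+ i) j = (j == i)%:R.
Proof.
suff -> : ddx ^+ i = 'X^i :> {poly K} by exact: coefXn.
by rewrite -iter_ddx_mul1; elim: i => //= i IHi; rewrite exprS ddxM IHi.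
Qed.

End DifferentialOperators.

Arguments ddx {K}.
Notation "f %:O" := (opC f) : ring_scope.

Section MonicOperators.
Variables (K : diffFieldType) (n : nat) (a : 'I_n.+1 -> K).

Definition monic_op : diffop K :=
  ddx ^+ n.+1 + \sum_(i < n.+1) (a i)%:O * ddx ^+ i.

Lemma op_coef_monic_op (i : nat) :
  op_coef monic_op i = if i == n.+1 then 1 else oapp a 0 (insub i).
Proof.
rewrite /op_coef /monic_op [(_ + _ : {poly K})`_i]coefD coef_sum.
under eq_bigr => j _.
  rewrite opC_mull [(_ *: _ : {poly K})`_i]coefZ [_`_i]op_coef_ddxXn.
  over.
rewrite [_`_i]op_coef_ddxXn; case: eqP => [->|_] /=.
  rewrite big1 ?addr0 // => j _.
  by rewrite eqn_leq [(n.+1 <= j)%N]leqNgt ltn_ord mulr0.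
rewrite add0r; case: insubP => [j _ ji|]/=; last first.
  rewrite -leqNgt => ni; rewrite big1 // => j _.
  by rewrite gtn_eqF ?mulr0 // (leq_trans (ltn_ord j)).
rewrite (bigD1 j) //= ji eqxx mulr1 big1 ?addr0 // => k.
by rewrite -(inj_eq val_inj) /= ji eq_sym => /negPf ->; rewrite mulr0.
Qed.

Lemma op_size_monic_op : op_size monic_op = n.+2.
Proof.
apply/eqP; rewrite eqn_leq; apply/andP; split.
  apply/leq_sizeP => i ni; rewrite [_`_i]op_coef_monic_op gtn_eqF //.
  by rewrite insubF // ltnNge ltnW.
rewrite ltnNge; apply/negP => /leq_sizeP/(_ n.+1 (leqnn _)) /eqP.
by rewrite [_`_n.+1]op_coef_monic_op eqxx oner_eq0.
Qed.

End MonicOperators.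

(* L^∨ = \sum_(i <= N) (-1)^(N + i) ∂^i a_i for L = \sum_(i <= N) a_i ∂^i of
   order N. *)
Definition dual_op (K : diffFieldType) (L : diffop K) : diffop K :=
  \sum_(i < op_size L)
     (-1) ^+ ((op_size L).-1 + i) * (ddx ^+ i * (op_coef L i)%:O).

Definition invertible (A : nzRingType) (x : A) : Prop :=
  exists y, y * x = 1 /\ x * y = 1.

Definition irreducible_elt (A : nzRingType) (x : A) : Prop :=
  [/\ x <> 0, ~ invertible x &
      forall y z, x = y * z -> invertible y \/ invertible z].

Section DifferentialModule.
Variables (K : diffFieldType) (L : diffop K).
Implicit Types (P Q : diffop K) (f g : K).

Definition left_ideal : {pred diffop K} :=
  fun P => `[< exists Q, P = Q * L >].

Lemma left_ideal_zmod_closed : zmod_closed left_ideal.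
Proof.
split=> [|P P' /asboolP[Q ->] /asboolP[Q' ->]]; apply/asboolP.
  by exists 0; rewrite mul0r.
by exists (Q - Q'); rewrite mulrBl.
Qed.

HB.instance Definition _ :=
  GRing.isZmodClosed.Build (diffop K) left_ideal left_ideal_zmod_closed.

Definition diffmod := Quotient.quot left_ideal.
HB.instance Definition _ := GRing.Zmodule.copy diffmod (Quotient.quot left_ideal).

Definition op_class P : diffmod := \pi_(Quotient.quot left_ideal) P.

(* The left K[∂]-module structure: P . [Q] = [P Q]. *)
Definition op_act P (m : diffmod) : diffmod :=
  op_class (P * repr (m : Quotient.quot left_ideal)).

Lemma op_class_eq P Q : op_class P = op_class Q <-> exists A, P - Q = A * L.
Proof.
rewrite (rwP eqP) /op_class /= -Quotient.idealrBE.
by split=> [/asboolP|] // H; apply/asboolP.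
Qed.

Lemma op_classP (m : diffmod) : exists P, m = op_class P.
Proof.
by exists (repr (m : Quotient.quot left_ideal)); rewrite /op_class reprK.
Qed.

Lemma op_act_class P Q : op_act P (op_class Q) = op_class (P * Q).
Proof.
set m := op_class Q; rewrite /op_act; apply/op_class_eq; rewrite -mulrBr.
have /op_class_eq[A ->] :
    op_class (repr (m : Quotient.quot left_ideal)) = op_class Q.
  by rewrite /op_class reprK.
by exists (P * A); rewrite mulrA.
Qed.

Lemma op_class_is_zmod_morphism : zmod_morphism op_class.
Proof. by move=> P Q; rewrite /op_class raddfB. Qed.

HB.instance Definition _ :=
  GRing.isZmodMorphism.Build (diffop K) diffmod op_class
    op_class_is_zmod_morphism.

Definition diffmod_scale f (m : diffmod) : diffmod := op_act f%:O m.

Lemma diffmod_scaleA f g m :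
  diffmod_scale f (diffmod_scale g m) = diffmod_scale (f * g) m.
Proof.
have [P ->] := op_classP m.
by rewrite /diffmod_scale !op_act_class mulrA -rmorphM.
Qed.

Lemma diffmod_scale1 : left_id 1 diffmod_scale.
Proof.
move=> m; have [P ->] := op_classP m.
by rewrite /diffmod_scale op_act_class rmorph1 mul1r.
Qed.

Lemma diffmod_scaleDr : right_distributive diffmod_scale +%R.
Proof.
move=> f m m'; have [P ->] := op_classP m; have [P' ->] := op_classP m'.
by rewrite /diffmod_scale -raddfD !op_act_class mulrDr raddfD.
Qed.

Lemma diffmod_scaleDl m : {morph diffmod_scale^~ m : f g / f + g}.
Proof.
move=> f g; have [P ->] := op_classP m.
by rewrite /diffmod_scale !op_act_class rmorphD mulrDl raddfD.
Qed.

HB.instance Definition _ := GRing.Zmodule_isLmodule.Build K diffmod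
  diffmod_scaleA diffmod_scale1 diffmod_scaleDr diffmod_scaleDl.

Definition diffmod_ddx (m : diffmod) : diffmod := op_act ddx m.

Definition diffmod_gen : diffmod := op_class 1.

End DifferentialModule.

Section Forms.
Variables (K : diffFieldType) (V : lmodType K).
Implicit Type B : {biscalar V}.

Definition symmetric_form B : Prop := forall u v, B u v = B v u.

Definition alternating_form B : Prop := forall u, B u u = 0.

Definition nondegenerate_form B : Prop :=
  (forall u, (forall v, B u v = 0) -> u = 0) /\
  (forall v, (forall u, B u v = 0) -> v = 0).

End Forms.

Definition property_P (K : diffFieldType) (n : nat) (L : diffop K) : Prop :=
  exists B : {biscalar diffmod L},
    [/\ nondegenerate_form B,
        if odd n then alternating_form B else symmetric_form B,
        forall m1 m2,
          der (B m1 m2) = B (diffmod_ddx m1) m2 + B m1 (diffmod_ddx m2) &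
        forall i, (i < n)%N ->
          B (diffmod_gen L) (iter i (@diffmod_ddx K L) (diffmod_gen L)) = 0].

(* Main.v *)
From HB Require Import structures.
Require Import Defs.
From mathcomp Require Import all_boot all_order all_algebra.
From mathcomp Require Import sesquilinear boolp functions.
From mathcomp Require Import reals complex ring.

(* Let V = K[d]/K[d]L, with cyclic vector e, and let D* be the dual connection
   on functionals V -> K.  The last coordinate functional c_n in the basis
   e, ..., d^n e is killed by L^v, and a functional phi with phi(d^i e) = 0 for
   i < n and phi(d^n e) <> 0 is killed by no nonzero operator of order <= n,
   because the matrix of the (D*^j phi)(d^i e) is anti-triangular.

   Given (P), <e, -> = beta c_n for some beta <> 0, so L beta - beta L^v has
   order <= n and kills c_n, hence vanishes.  Conversely, if
   L alpha = alpha L^v, then <P e, v> := (P (alpha c_n))(v) is well defined and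
   compatible with d; it is (-1)^n-symmetric because a compatible form is
   determined by the functional <e, ->.  The equation for alpha compares
   coefficients of d^n. *)

Set Implicit Arguments.
Unset Strict Implicit.
Unset Printing Implicit Defensive.

Import Order.TTheory GRing.Theory Num.Theory.
Local Open Scope ring_scope.

(** * Coefficients of ∂^i f, L f and L^v *)

Section OperatorCoefficients.
Variable K : diffFieldType.
Implicit Types (f : K) (q : {poly K}) (L : diffop K).

Lemma coef_ddx_mul q i :
  (ddx_mul q)`_i = (if i is j.+1 then q`_j else 0) + der q`_i.
Proof.
by rewrite coefD coef_map_id0 ?raddf0 // coefXM; case: i.
Qed.

(** By the Leibniz rule, ∂^i f is the sum of binom(i,j) f^(i-j) ∂^j over j <= i. Of this expansion
    only the vanishing above i and the coefficients at i and i-1 are needed. *)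
Lemma coef_iter_ddxC_gt f i j : (i < j)%N -> (iter i (@ddx_mul K) f%:P)`_j = 0.
Proof.
elim: i j => [|i IHi] [|j] //= ij; first by rewrite coefC.
by rewrite coef_ddx_mul !IHi ?raddf0 ?addr0 // ltnW.
Qed.

Lemma coef_iter_ddxC_diag f i : (iter i (@ddx_mul K) f%:P)`_i = f.
Proof.
elim: i => [|i IHi] /=; first by rewrite coefC.
by rewrite coef_ddx_mul IHi coef_iter_ddxC_gt // raddf0 addr0.
Qed.

Lemma coef_iter_ddxC_sub f i :
  (iter i.+1 (@ddx_mul K) f%:P)`_i = der f *+ i.+1.
Proof.
elim: i => [|i IHi]; first by rewrite /= coef_ddx_mul coefC add0r.
rewrite [iter _ _ _]/= coef_ddx_mul -[ddx_mul _]/(iter i.+1 _ f%:P) IHi.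
by rewrite coef_iter_ddxC_diag -mulrSr.
Qed.

Lemma ddxXnM i q : (ddx ^+ i : diffop K) * q = iter i (@ddx_mul K) q.
Proof.
elim: i => [|i IHi]; first by rewrite expr0 mul1r.
by rewrite exprS -mulrA IHi ddxM.
Qed.

Lemma dual_opE L :
  dual_op L = \sum_(i < op_size L) (-1) ^+ ((op_size L).-1 + i) *:
    iter i (@ddx_mul K) (op_coef L i)%:P :> {poly K}.
Proof.
apply: eq_bigr => i _; rewrite ddxXnM -[RHS]opC_mull.
by rewrite rmorphXn /= rmorphN1.
Qed.

(** The right-hand side is the definition of [diffop_mul], so this holds by conversion. *)
Lemma op_mulC L f :
  L * f%:O = \sum_(i < op_size L) op_coef L i *: iter i (@ddx_mul K) f%:P
  :> {poly K}.
Proof. by []. Qed.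

Lemma coef_sum_iter_ddxC_gt (c g : nat -> K) N j : (N <= j)%N ->
  (\sum_(i < N) c i *: iter i (@ddx_mul K) (g i)%:P)`_j = 0.
Proof.
move=> Nj; rewrite coef_sum big1 // => i _; rewrite coefZ.
by rewrite coef_iter_ddxC_gt ?mulr0 // (leq_trans (ltn_ord i)).
Qed.

Lemma coef_sum_iter_ddxC_top (c g : nat -> K) N :
  (\sum_(i < N.+1) c i *: iter i (@ddx_mul K) (g i)%:P)`_N = c N * g N.
Proof.
rewrite big_ord_recr coefD coef_sum_iter_ddxC_gt // add0r coefZ.
by rewrite coef_iter_ddxC_diag.
Qed.

Lemma coef_sum_iter_ddxC_sub (c g : nat -> K) N :
  (\sum_(i < N.+2) c i *: iter i (@ddx_mul K) (g i)%:P)`_N =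
  c N * g N + c N.+1 * (der (g N.+1) *+ N.+1).
Proof.
rewrite big_ord_recr coefD coef_sum_iter_ddxC_top coefZ.
by rewrite coef_iter_ddxC_sub.
Qed.

End OperatorCoefficients.

(** * Differential operators acting through a connection *)

Section OperatorAction.
Variable K : diffFieldType.
Implicit Types (f : K) (P Q : diffop K).

Definition connection (W : lmodType K) (D : W -> W) : Prop :=
  zmod_morphism D /\ forall f w, D (f *: w) = der f *: w + f *: D w.

(** The action in which ∂ acts as D; when D is a connection it is a module action, by [dactM]. *)
Definition dact (W : lmodType K) (D : W -> W) P (w : W) : W :=
  \sum_(i < op_size P) op_coef P i *: iter i D w.

Section Connection.
Variables (W : lmodType K) (D : W -> W).

Lemma dactE N P w : (op_size P <= N)%N ->
  dact D P w = \sum_(i < N) op_coef P i *: iter i D w.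
Proof.
move=> PN.
rewrite /dact (big_ord_widen N (fun i => op_coef P i *: iter i D w)) //.
rewrite big_mkcond; apply: eq_bigr => i _; case: ifPn => //.
by rewrite -leqNgt => Pi; rewrite /op_coef nth_default ?scale0r.
Qed.

Lemma dact_is_linear w : linear (dact D ^~ w).
Proof.
move=> f P Q; pose N := maxn (op_size P) (op_size Q).
have sPN : (op_size P <= N)%N by rewrite leq_maxl.
have sQN : (op_size Q <= N)%N by rewrite leq_maxr.
rewrite !(dactE (N := N)) //.
  rewrite scaler_sumr -big_split; apply: eq_bigr => i _.
  by rewrite /op_coef coefD coefZ scalerDl scalerA.
apply: leq_trans (size_polyD _ _) _; rewrite geq_max sQN andbT.
exact: leq_trans (size_scale_leq _ _) sPN.
Qed.

Lemma dactB P Q w : dact D (P - Q) w = dact D P w - dact D Q w.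
Proof. exact: (zmod_morphism_linear (dact_is_linear w)). Qed.

Lemma dactZ f P w : dact D (f *: P) w = f *: dact D P w.
Proof. exact: (scalable_linear (dact_is_linear w)). Qed.

Lemma dact0 w : dact D 0 w = 0.
Proof. by rewrite -[0 in LHS](subrr 0) dactB subrr. Qed.

Lemma dact_sum I (s : seq I) (G : I -> diffop K) w :
  dact D (\sum_(i <- s) G i) w = \sum_(i <- s) dact D (G i) w.
Proof.
apply: (big_morph (dact D ^~ w)) => [P Q|]; last exact: dact0.
by rewrite -[P]scale1r dact_is_linear !scale1r.
Qed.

Lemma dact1 w : dact D 1 w = w.
Proof.
by rewrite /dact /op_size size_poly1 big_ord1 /op_coef coef1 scale1r.
Qed.

Lemma dactC f w : dact D f%:O w = f *: w.
Proof. by rewrite -[f%:O]mulr1 opC_mull dactZ dact1. Qed.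

Hypothesis DP : connection D.

Lemma connection0 : D 0 = 0.
Proof. by rewrite -[0 in LHS](subrr 0) DP.1 subrr. Qed.

Lemma connectionD u v : D (u + v) = D u + D v.
Proof.
have -> : u + v = u - (0 - v) by rewrite sub0r opprK.
by rewrite !DP.1 connection0 sub0r opprK.
Qed.

Lemma iter_connection0 i : iter i D 0 = 0.
Proof. by elim: i => //= i ->; apply: connection0. Qed.

Lemma iter_connectionD i u v : iter i D (u + v) = iter i D u + iter i D v.
Proof. by elim: i => //= i ->; apply: connectionD. Qed.

Lemma dact_0 P : dact D P 0 = 0.
Proof. by apply: big1 => i _; rewrite iter_connection0 scaler0. Qed.

(** The Leibniz rule for D mirrors ∂ p = p ∂ + p'. Both sums are padded to the same length because ∂
    raises the order by one. *)
Lemma dact_ddx P w : dact D (ddx * P) w = D (dact D P w).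
Proof.
have sP : (op_size (ddx * P)%R <= (op_size P).+1)%N.
  apply/leq_sizeP => -[|j] // Pj.
  by rewrite ddxM coef_ddx_mul !nth_default ?raddf0 ?addr0 //; apply: leqW.
rewrite (dactE _ sP) (dactE _ (leqnSn (op_size P))).
have -> : D (\sum_(i < (op_size P).+1) op_coef P i *: iter i D w)
    = \sum_(i < (op_size P).+1)
        (der (op_coef P i) *: iter i D w + op_coef P i *: iter i.+1 D w).
  rewrite (big_morph D connectionD connection0).
  by apply: eq_bigr => i _; rewrite DP.2.
rewrite big_split /= [X in _ = _ + X]big_ord_recr /=.
rewrite [op_coef P _]nth_default // scale0r addr0.
under eq_bigr => i _ do rewrite /op_coef ddxM coef_ddx_mul scalerDl.
by rewrite big_split big_ord_recl /= scale0r add0r addrC.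
Qed.

Lemma dact_ddxXn i P w : dact D (ddx ^+ i * P) w = iter i D (dact D P w).
Proof.
elim: i => [|i IHi]; first by rewrite expr0 mul1r.
by rewrite exprS -mulrA dact_ddx IHi.
Qed.

Lemma dactM P Q w : dact D (P * Q) w = dact D P (dact D Q w).
Proof.
have -> : P * Q = \sum_(i < op_size P) op_coef P i *: (ddx ^+ i * Q).
  by apply: eq_bigr => i _; rewrite ddxXnM.
by rewrite dact_sum; apply: eq_bigr => i _; rewrite dactZ dact_ddxXn.
Qed.

End Connection.

(** Horizontal linear maps respect the whole action. This serves for reduction modulo L and for u ->
    <u, ->. *)
Lemma dact_morph (W1 W2 : lmodType K) (D1 : W1 -> W1) (D2 : W2 -> W2)
    (h : {linear W1 -> W2}) :
  (forall w, h (D1 w) = D2 (h w)) ->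
  forall P w, h (dact D1 P w) = dact D2 P (h w).
Proof.
move=> hD P w; rewrite linear_sum; apply: eq_bigr => i _.
by rewrite linearZ_LR; congr (_ *: _); elim: (nat_of_ord i) => //= j <-.
Qed.

End OperatorAction.

(** * The dual connection and cyclic vectors *)

Section DualConnection.
Variables (K : diffFieldType) (W : lmodType K) (D : W -> W).
Implicit Types (f : K) (P Q : diffop K) (phi : W -> K^o).

(** Defined on all functions W -> K, which already form a K-module; linearity is carried separately
    by [scalar]. *)
Definition dual_der phi : W -> K^o := fun w => der (phi w : K) - phi (D w).

Lemma dual_der_connection : connection dual_der.
Proof.
split=> [phi psi|f phi]; apply/funext => w; rewrite /dual_der !fctE /=.
  by rewrite raddfB !opprD !opprK addrACA.
by rewrite /GRing.scale /= derM mulrBr addrA.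
Qed.

Hypothesis DP : connection D.

Lemma dual_der_scalar phi : scalar phi -> scalar (dual_der phi).
Proof.
move=> phiP f u v; rewrite /dual_der.
have D_lin : D (f *: u + v) = der f *: u + (f *: D u + D v).
  by rewrite connectionD // DP.2 addrA.
rewrite D_lin !phiP raddfD /= derM mulrBr opprD.
by rewrite -!/(GRing.scale _ _) /GRing.scale /=; ring.
Qed.

Lemma dact_dual_scalar P phi : scalar phi -> scalar (dact dual_der P phi).
Proof.
move=> phiP f u v; rewrite /dact !fct_sumE mulr_sumr -big_split.
apply: eq_bigr => i _.
have iterP : scalar (iter i dual_der phi).
  by elim: (nat_of_ord i) => //= j; apply: dual_der_scalar.
by rewrite !fctE iterP /GRing.scale /= mulrDr mulrCA.
Qed.

Section CyclicVector.
Variables (n : nat) (w : W) (phi : W -> K^o).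
Hypothesis phi0 : forall i, (i < n)%N -> phi (iter i D w) = 0.

(** Each further D* yields a derivative term, which is the derivative of a value of phi below index
    n, hence 0; only the sign and the shift remain. *)
Lemma iter_dual_der i j : (i + j <= n)%N ->
  iter j dual_der phi (iter i D w) = (-1) ^+ j * phi (iter (i + j) D w).
Proof.
elim: j i => [|j IHj] i /=; first by rewrite addn0 expr0 mul1r.
rewrite addnS => ijn; rewrite /dual_der -iterS !IHj ?addSn // 1?ltnW //.
by rewrite phi0 // mulr0 raddf0 sub0r exprS mulN1r mulNr.
Qed.

Lemma dact_dual_eq0 Q : phi (iter n D w) != 0 -> (op_size Q <= n.+1)%N ->
  dact dual_der Q phi = 0 -> Q = 0.
Proof.
move=> phin sQ Qphi; apply/eqP; apply/negPn/negP => Q0.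
have [d sQd] : exists d, op_size Q = d.+1.
  by exists (op_size Q).-1; rewrite prednK // lt0n size_poly_eq0.
have dn : (d <= n)%N by rewrite sQd in sQ.
(* With d the order of Q, evaluation at D^(n-d) w isolates the leading term: the terms with i < d
   involve phi only at indices n-d+i < n. *)
have := congr1 (@^~ (iter (n - d) D w)) Qphi.
rewrite /dact sQd fct_sumE big_ord_recr /= big1 => [|i _].
  rewrite !fctE iter_dual_der subnK // add0r => /eqP.
  rewrite !mulf_eq0 signr_eq0 (negPf phin) /= orbF.
  have -> : op_coef Q d = lead_coef Q by rewrite lead_coefE -/(op_size _) sQd.
  by rewrite lead_coef_eq0 (negPf Q0).
have idn : (n - d + i < n)%N.
  by rewrite -[X in (_ < X)%N](subnK dn) ltn_add2l.
by rewrite !fctE iter_dual_der ?phi0 ?mulr0 ?scaler0 //; apply: ltnW.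
Qed.

End CyclicVector.

End DualConnection.

(** * The differential module of L *)

Section DifferentialModuleTheory.
Variables (K : diffFieldType) (L : diffop K).
Implicit Types (f : K) (P Q : diffop K).
Local Notation V := (diffmod L).
Local Notation D := (@diffmod_ddx K L).
Local Notation e := (diffmod_gen L).

Lemma diffmod_scale_class f P : f *: op_class L P = op_class L (f *: P).
Proof.
by rewrite -[LHS]/(op_act f%:O (op_class L P)) op_act_class opC_mull.
Qed.

Lemma op_class_is_linear : linear (op_class L).
Proof. by move=> f P Q; rewrite diffmod_scale_class raddfD. Qed.

Lemma diffmod_ddx_class P : D (op_class L P) = op_class L (ddx * P).
Proof. exact: op_act_class. Qed.

Lemma diffmod_ddx_connection : connection D.
Proof.
split=> [m m'|f m]; have [P ->] := op_classP m.
  have [Q ->] := op_classP m'.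
  by rewrite -raddfB !diffmod_ddx_class mulrBr raddfB.
rewrite diffmod_scale_class !diffmod_ddx_class !diffmod_scale_class -raddfD.
by rewrite !ddxM ddx_mulZ.
Qed.

Lemma dact_diffmod P Q : dact D P (op_class L Q) = op_class L (P * Q).
Proof.
have -> : P * Q = \sum_(i < op_size P) op_coef P i *: (ddx ^+ i * Q).
  by apply: eq_bigr => i _; rewrite ddxXnM.
rewrite raddf_sum; apply: eq_bigr => i _.
rewrite -[RHS]/(op_class L _) -diffmod_scale_class; congr (_ *: _).
elim: (nat_of_ord i) => [|j IHj] /=; first by rewrite expr0 mul1r.
by rewrite IHj diffmod_ddx_class exprS -mulrA.
Qed.

Lemma dact_gen P : dact D P e = op_class L P.
Proof. by rewrite dact_diffmod mulr1. Qed.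

Lemma op_class_mull Q : op_class L (Q * L) = 0.
Proof.
by rewrite -(raddf0 (op_class L)); apply/op_class_eq; exists Q; rewrite subr0.
Qed.

Lemma op_class_self : op_class L L = 0.
Proof. by rewrite -(op_class_mull 1) mul1r. Qed.

(** * Remainders modulo a monic operator and coordinates *)

Section Monic.
Variable n : nat.
Hypotheses (sizeL : op_size L = n.+2) (monL : op_coef L n.+1 = 1).

Lemma ddx_mulXn i : ddx_mul ('X^i : {poly K}) = 'X^(i.+1).
Proof. by rewrite -!(@iter_ddx_mul1 K). Qed.

(* The companion map: left multiplication by d/dz on remainders modulo L. *)
Definition companion (r : {poly K}) : {poly K} :=
  ddx_mul r - r`_n *: (L : {poly K}).

Lemma companion_connection : connection companion.
Proof.
rewrite /companion; split=> [r s|f r]; last first.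
  by rewrite ddx_mulZ coefZ scalerBr scalerA addrA.
by rewrite raddfB coefB scalerBl !opprD !opprK addrACA.
Qed.

(** The remainder of P on right division by L, obtained by letting P act on 1 rather than by
    Euclidean division; multiplicativity then comes from [dactM]. *)
Definition op_rem P : {poly K} := dact companion P 1.

Lemma iter_companion1 i : (i <= n)%N -> iter i companion 1 = 'X^i.
Proof.
elim: i => [|i IHi] ilen; first by rewrite expr0.
rewrite iterS (IHi (ltnW ilen)) /companion coefXn (gtn_eqF ilen).
by rewrite scale0r subr0 ddx_mulXn.
Qed.

Lemma op_rem_small P : (op_size P <= n.+1)%N -> op_rem P = P.
Proof.
move=> sP; rewrite /op_rem (dactE _ _ sP) -[RHS](@coefK _ P) poly_def.
rewrite (big_ord_widen n.+1 (fun i => P`_i *: 'X^i)) // [RHS]big_mkcond.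
apply: eq_bigr => i _; rewrite iter_companion1 -1?ltnS //; case: ifPn => //.
by rewrite -leqNgt => Pi; rewrite /op_coef nth_default ?scale0r.
Qed.

Lemma op_rem_self : op_rem L = 0.
Proof.
rewrite /op_rem /dact sizeL big_ord_recr /= monL scale1r iter_companion1 //.
(* The top term of L contributes ∂^(n+1) - L, and the lower terms contribute L - ∂^(n+1). *)
rewrite /companion coefXn eqxx scale1r.
under eq_bigr => i _ do rewrite iter_companion1 -1?ltnS //.
rewrite ddx_mulXn.
rewrite addrA -[X in _ - X](@coefK _ L) poly_def -/(op_size L) sizeL.
by rewrite [X in _ - X]big_ord_recr /= [L`_n.+1]monL scale1r subrr.
Qed.

Lemma op_rem_mull Q : op_rem (Q * L) = 0.
Proof.
rewrite /op_rem (dactM companion_connection) -/(op_rem L) op_rem_self.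
by rewrite (dact_0 companion_connection).
Qed.

Lemma op_rem_ddx P : op_rem (ddx * P) = companion (op_rem P).
Proof. exact: (dact_ddx companion_connection). Qed.

Lemma op_remB P Q : op_rem (P - Q) = op_rem P - op_rem Q.
Proof. exact: dactB. Qed.

(** If r has order at most n, the coefficient of ∂ r at n+1 is that of r at n, and [companion]
    cancels it because L is monic. *)
Lemma size_op_rem P : (size (op_rem P) <= n.+1)%N.
Proof.
have size_companion (r : {poly K}) :
    (size r <= n.+1)%N -> (size (companion r) <= n.+1)%N.
  move=> sr; apply/leq_sizeP => -[|j] // nj.
  rewrite coefB coefZ coef_ddx_mul [r`_j.+1]nth_default ?(leq_trans sr) //.
  rewrite raddf0 addr0; move: nj; rewrite ltnS leq_eqVlt => /orP[/eqP <-|nj].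
    by rewrite [L`_n.+1]monL mulr1 subrr.
  rewrite [r`_j]nth_default ?(leq_trans sr) // [L`_j.+1]nth_default.
    by rewrite mulr0 subr0.
  by rewrite -/(op_size L) sizeL.
apply/leq_sizeP => j nj; rewrite /op_rem /dact coef_sum big1 // => i _.
rewrite coefZ nth_default ?mulr0 // (leq_trans _ nj) //.
by elim: (nat_of_ord i) => [|k]; [rewrite size_poly1 | apply: size_companion].
Qed.

(** Reduction modulo L kills the multiple of L in [companion], so it intertwines [companion] with ∂;
    it also sends 1 to e. *)
Lemma op_class_rem P : op_class L (op_rem P) = op_class L P.
Proof.
rewrite -[RHS]dact_gen /op_rem.
pose h : {linear {poly K} -> diffmod L} :=
  HB.pack (op_class L : {poly K} -> diffmod L)
    (GRing.isLinear.Build _ _ _ _ (op_class L) op_class_is_linear).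
rewrite -[LHS]/(h _) (@dact_morph _ _ _ companion D) // => r /=.
rewrite -[D _]/(D (op_class L r)) diffmod_ddx_class ddxM /companion.
rewrite [LHS](raddfB (op_class L)) /= -diffmod_scale_class.
by rewrite op_class_self scaler0 subr0.
Qed.

(** For k <= n this is the coordinate c_k in the basis e, ..., ∂^n e. It is read off a chosen
    representative; [rem_coord_class] shows independence of the choice. *)
Definition rem_coord k (m : diffmod L) : K^o :=
  (op_rem (repr (m : Quotient.quot (left_ideal L))))`_k.

Lemma rem_coord_class k P : rem_coord k (op_class L P) = (op_rem P)`_k.
Proof.
rewrite /rem_coord; set Q := repr _.
have /op_class_eq[A QP] : op_class L Q = op_class L P.
  by rewrite /Q /op_class reprK.
by apply/eqP; rewrite -subr_eq0 -coefB -op_remB QP op_rem_mull coef0.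
Qed.

Lemma rem_coord_scalar k : scalar (rem_coord k).
Proof.
move=> f m m'; have [P ->] := op_classP m; have [Q ->] := op_classP m'.
rewrite -op_class_is_linear !rem_coord_class /op_rem dact_is_linear.
by rewrite coefD coefZ.
Qed.

Lemma iter_ddx_gen i : iter i D e = op_class L (ddx ^+ i).
Proof.
elim: i => [|i /= ->]; first by rewrite expr0.
by rewrite diffmod_ddx_class exprS.
Qed.

Lemma rem_coord_basis i : (i <= n)%N -> rem_coord n (iter i D e) = (i == n)%:R.
Proof.
move=> ilen; rewrite iter_ddx_gen rem_coord_class -[ddx ^+ i]mulr1.
rewrite /op_rem (dact_ddxXn companion_connection) dact1 iter_companion1 //.
by rewrite coefXn eq_sym.
Qed.

Lemma diffmod_basis m :
  m = \sum_(i < n.+1) (rem_coord i m : K) *: iter i D e.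
Proof.
have [P ->] := op_classP m; rewrite -[LHS]op_class_rem -dact_gen.
rewrite (dactE _ _ (size_op_rem P)).
by apply: eq_bigr => i _; rewrite rem_coord_class.
Qed.

Lemma eq_scalar_diffmod (phi psi : diffmod L -> K^o) :
  scalar phi -> scalar psi ->
  (forall i, (i <= n)%N -> phi (iter i D e) = psi (iter i D e)) -> phi = psi.
Proof.
move=> phiP psiP eq_b; apply/funext => m; rewrite [m]diffmod_basis.
have scalar_sum (chi : diffmod L -> K^o) : scalar chi ->
    chi (\sum_(i < n.+1) (rem_coord i m : K) *: iter i D e) =
    \sum_(i < n.+1) (rem_coord i m : K) * chi (iter i D e).
  move=> chiP; pose c : {scalar diffmod L} :=
    HB.pack chi (GRing.isLinear.Build _ _ _ _ chi chiP).
  rewrite -[chi]/(c : _ -> _) linear_sum.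
  by apply: eq_bigr => i _; rewrite linearZ.
rewrite !scalar_sum //; apply: eq_bigr => i _.
by rewrite eq_b // -ltnS.
Qed.

(* The coordinates c_k satisfy a_k c_n = c_(k-1) + D^* c_k, so the sum
   defining L^v c_n telescopes. *)
Lemma dual_op_coord : dact (dual_der D) (dual_op L) (rem_coord n) = 0.
Proof.
have dualP := dual_der_connection D.
(* Indices are shifted by one, so that the recursion covers k = 0 with [c 0] zero. At the other end
   [c n.+2] is zero because remainders have order at most n. *)
pose c k : diffmod L -> K^o := if k is j.+1 then rem_coord j else 0.
have cE k : op_coef L k *: rem_coord n = c k + dual_der D (c k.+1).
  apply/funext => m; have [P ->] := op_classP m.
  rewrite !fctE /dual_der /c diffmod_ddx_class !rem_coord_class op_rem_ddx.
  rewrite [companion _]/companion coefB coefZ coef_ddx_mul /GRing.scale /=.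
  case: k => [|k]; last by rewrite rem_coord_class /op_coef; ring.
  by rewrite -[0 (op_class L P)]/(0 : K) /op_coef; ring.
pose t k := (-1) ^+ k *: iter k (dual_der D) (c k).
rewrite dual_opE dact_sum sizeL.
have tE (i : 'I_n.+2) :
    dact (dual_der D) ((-1) ^+ (n.+1 + i) *:
      iter i (@ddx_mul K) (op_coef L i)%:P) (rem_coord n)
    = (-1) ^+ n *: (t i.+1 - t i).
  rewrite dactZ -[iter _ _ _]ddxXnM (dact_ddxXn dualP) dactC cE.
  rewrite iter_connectionD // /t -iterSr /= -iterS addSnnS exprD -scalerA.
  congr (_ *: _); rewrite scalerDr addrC; congr (_ + _).
  by rewrite exprS mulN1r scaleNr.
under eq_bigr => i _ do rewrite tE.
rewrite -scaler_sumr -(big_mkord xpredT (fun i => t i.+1 - t i)).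
rewrite telescope_sumr // /t.
have -> : c n.+2 = 0.
  apply/funext => m; have [P ->] := op_classP m.
  by rewrite [LHS]rem_coord_class nth_default ?size_op_rem.
by rewrite !(iter_connection0 dualP) !scaler0 subr0 scaler0.
Qed.

(** * Comparison of L f with f L^v *)

Lemma coef_dual_comm_gt f i : (n < i)%N ->
  op_coef (L * f%:O - f%:O * dual_op L) i = 0.
Proof.
move=> ni; rewrite /op_coef op_mulC opC_mull dual_opE sizeL coefB coefZ.
pose sgn i : K := (-1) ^+ (n.+1 + i).
rewrite -/(sgn _); move: ni; rewrite leq_eqVlt => /orP[/eqP <-|ni].
  (* At index n+1 both operators have coefficient f, the sign in L^v being (-1)^(2n+2). *)
  rewrite (coef_sum_iter_ddxC_top _ (fun=> f)) (coef_sum_iter_ddxC_top sgn).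
  by rewrite /sgn addnn -mul2n exprM sqrrN !expr1n monL !mul1r mulr1 subrr.
rewrite (coef_sum_iter_ddxC_gt _ (fun=> f)) //.
by rewrite (coef_sum_iter_ddxC_gt sgn) // mulr0 subrr.
Qed.

(** The coefficient of ∂^n is a_n f + (n+1) f' on the left and - a_n f on the right, since the
    derivative of a_(n+1) = 1 vanishes. *)
Lemma self_dual_der f : (n.+1%:R : K) != 0 ->
  L * f%:O = f%:O * dual_op L ->
  der f = - (2%:R / n.+1%:R) * op_coef L n * f.
Proof.
move=> n1 Lf; apply: (mulfI n1).
have -> : n.+1%:R * (- (2%:R / n.+1%:R) * op_coef L n * f) =
    - 2%:R * op_coef L n * f by rewrite !mulrA mulrN mulrCA divff ?mulr1.
have := congr1 (fun P : diffop K => op_coef P n) Lf.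
pose sgn i : K := (-1) ^+ (n.+1 + i).
rewrite /op_coef op_mulC opC_mull dual_opE sizeL coefZ.
rewrite (coef_sum_iter_ddxC_sub _ (fun=> f)) (coef_sum_iter_ddxC_sub sgn).
rewrite monL der1 mul0rn mulr0 addr0 /sgn addSn exprS addnn -mul2n exprM.
rewrite sqrrN !expr1n mulr1 mul1r mulN1r => top_coef.
apply: (addrI (op_coef L n * f)); rewrite mulr_natl top_coef /op_coef.
by ring.
Qed.

(** * The two implications *)

Lemma property_P_self_dual : property_P n L ->
  exists2 f : K, f != 0 & L * f%:O = f%:O * dual_op L.
Proof.
case=> B [[ndl _] _ Bder Be].
have dualP := dual_der_connection D.
pose b (u : V) : V -> K^o := B u.
have bP : linear b.
  by move=> f u v; apply/funext => w; rewrite /b linearPl.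
have b_scalar u : scalar (b u) by move=> f v w; rewrite /b linearPr.
have bD u : b (D u) = dual_der D (b u).
  by apply/funext => v; rewrite /dual_der /b Bder addrK.
pose beta : K := b e (iter n D e).
have beE : b e = beta *: rem_coord n.
  apply: eq_scalar_diffmod => // [f v w|i ilen].
    by rewrite !fctE rem_coord_scalar /GRing.scale /= mulrDr mulrCA.
  rewrite fctE rem_coord_basis //; case: eqVneq => [->|i_neq].
    by rewrite /GRing.scale /= mulr1.
  by rewrite scaler0 [LHS]Be // ltn_neqAle i_neq.
(* Otherwise <e, -> = 0 and e = 0 by non-degeneracy, whereas 1 is its own remainder. *)
have beta0 : beta != 0.
  apply/eqP => beta0; have e0 : e = 0.
    by apply: ndl => v; rewrite -[LHS]/(b e v) beE beta0 scale0r.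
  have := rem_coord_basis (leq0n n); have := congr1 (rem_coord 0) e0.
  rewrite -(raddf0 (op_class L)) !rem_coord_class.
  rewrite !op_rem_small /op_size ?size_poly0 ?size_poly1 //.
  by rewrite coef0 coef1 => /eqP; rewrite oner_eq0.
(* Compatibility makes u -> <u, -> horizontal, so L <e, -> = <L e, -> = 0. *)
have Lbe : dact (dual_der D) L (b e) = 0.
  pose h : {linear V -> (V -> K^o)} :=
    HB.pack b (GRing.isLinear.Build _ _ _ _ b bP).
  rewrite -[b e]/(h e) -(@dact_morph _ _ _ D _ h bD) dact_gen.
  by rewrite op_class_self raddf0.
exists beta => //; apply/eqP; rewrite -subr_eq0; apply/eqP.
apply: (@dact_dual_eq0 _ _ D n e (rem_coord n)).
- by move=> i ilt; rewrite rem_coord_basis ?(ltn_eqF ilt) // ltnW.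
- by rewrite rem_coord_basis // eqxx oner_neq0.
- by apply/leq_sizeP => i ni; apply: coef_dual_comm_gt.
rewrite dactB !(dactM dualP) dactC -beE Lbe dual_op_coord.
by rewrite dactC scaler0 subrr.
Qed.

Lemma self_dual_property_P f : (2%:R : K) != 0 -> f != 0 ->
  L * f%:O = f%:O * dual_op L -> property_P n L.
Proof.
move=> K2 f0 Lf; have dualP := dual_der_connection D.
have DP := diffmod_ddx_connection.
pose phi := f *: rem_coord n.
have phiP : scalar phi.
  move=> g v w; rewrite /phi !fctE rem_coord_scalar /GRing.scale /=.
  by rewrite mulrDr mulrCA.
have phi_lt i : (i < n)%N -> phi (iter i D e) = 0.
  move=> ilt; rewrite /phi fctE rem_coord_basis 1?ltnW // (ltn_eqF ilt).
  exact: scaler0.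
have phi_n : phi (iter n D e) = f.
  by rewrite /phi fctE rem_coord_basis // eqxx; apply: mulr1.
(* L (f c_n) = f (L^v c_n) = 0; this makes [B0] below independent of representatives. *)
have Lphi : dact (dual_der D) L phi = 0.
  rewrite /phi -(dactC (dual_der D)) -(dactM dualP) Lf (dactM dualP).
  by rewrite dual_op_coord (dact_0 dualP).
pose B0 (u v : V) : K :=
  dact (dual_der D) (repr (u : Quotient.quot (left_ideal L))) phi v.
have B0E P v : B0 (op_class L P) v = dact (dual_der D) P phi v.
  rewrite /B0; set Q := repr _.
  have /op_class_eq[A QP] : op_class L Q = op_class L P.
    by rewrite /Q /op_class reprK.
  apply/eqP; rewrite -subr_eq0; apply/eqP.
  rewrite -[LHS]/((dact (dual_der D) Q phi - dact (dual_der D) P phi) v).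
  by rewrite -dactB QP (dactM dualP) Lphi (dact_0 dualP).
have B0l v : scalar (B0 ^~ v).
  move=> g u u'; have [P ->] := op_classP u; have [Q ->] := op_classP u'.
  by rewrite -op_class_is_linear !B0E dact_is_linear.
have B0r u : scalar (B0 u).
  have [P ->] := op_classP u => g v w; rewrite !B0E.
  exact: (dact_dual_scalar DP).
pose B : {biscalar V} := HB.pack B0
  (bilinear_isBilinear.Build K V V K _ _ B0 (B0l, B0r)).
have BD u v : der (B0 u v) = B0 (D u) v + B0 u (D v).
  have [P ->] := op_classP u; rewrite diffmod_ddx_class !B0E.
  by rewrite (dact_ddx dualP) subrK.
have B0e v : B0 e v = phi v by rewrite B0E dact1.
(* The maps u -> <u, -> and u -> (-1)^n <-, u> are both linear and horizontal, so agreement at e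
   gives agreement at every P e. *)
have Bsym u v : B0 u v = (-1) ^+ n * B0 v u.
  pose b w : V -> K^o := fun z => (-1) ^+ n * B0 z w.
  have bP : linear b.
    move=> g w w'; apply/funext => z; rewrite /b !fctE B0r mulrDr.
    by rewrite /GRing.scale /= mulrCA.
  have bD w : b (D w) = dual_der D (b w).
    apply/funext => z; rewrite /dual_der /b.
    have -> : der ((-1) ^+ n * B0 z w) = (-1) ^+ n * der (B0 z w).
      by rewrite -signr_odd; case: odd; rewrite ?mul1r // !mulN1r raddfN.
    by rewrite BD mulrDr addrAC subrr add0r.
  have be : b e = phi.
    apply: eq_scalar_diffmod => // [g z z'|i ilen].
      by rewrite /b B0l mulrDr mulrCA.
    (* Here <∂^i e, e> = (-1)^i phi(∂^i e): both sides vanish for i < n, and for i = n the two signs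
       cancel. *)
    rewrite /b [in LHS]iter_ddx_gen B0E -[ddx ^+ i]mulr1 (dact_ddxXn dualP).
    rewrite dact1 -[X in _ * iter _ _ _ X]/(iter 0 D e).
    rewrite (iter_dual_der phi_lt) ?add0n //.
    move: ilen; rewrite leq_eqVlt => /orP[/eqP ->|ilt].
      by rewrite mulrA -expr2 sqrr_sign mul1r.
    by rewrite phi_lt // !mulr0.
  have [P ->] := op_classP u.
  pose h : {linear V -> (V -> K^o)} :=
    HB.pack b (GRing.isLinear.Build _ _ _ _ b bP).
  rewrite B0E -be -[b e]/(h e) -(@dact_morph _ _ _ D _ h bD) dact_gen.
  by [].
(* The remainder representing u has order at most n and kills phi, hence is zero. *)
have B0ndl u : (forall v, B0 u v = 0) -> u = 0.
  have [P ->] := op_classP u; rewrite -op_class_rem => BP0.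
  suff -> : op_rem P = 0 by rewrite raddf0.
  apply: (dact_dual_eq0 phi_lt); rewrite ?phi_n ?size_op_rem //.
  by apply/funext => v; rewrite -B0E BP0.
exists B; split.
- split=> [//|v Bv0]; apply: B0ndl => u.
  by rewrite Bsym [B0 u v]Bv0 mulr0.
- case: ifP => nodd u; last first.
    by move=> v; rewrite -[LHS]/(B0 u v) Bsym -signr_odd nodd mul1r.
  (* Antisymmetry gives 2 <u, u> = 0, and 2 is nonzero in K. *)
  have /eqP := Bsym u u; rewrite -signr_odd nodd expr1 mulN1r -addr_eq0.
  by rewrite -mulr2n -mulr_natl mulf_eq0 (negPf K2) => /eqP.
- exact: BD.
by move=> i ilt; rewrite -[LHS]/(B0 e _) B0e phi_lt.
Qed.

End Monic.
End DifferentialModuleTheory.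

(** * Specialisation to rational functions *)

Lemma op_coef_monic_op_top (K : diffFieldType) n (a : 'I_n.+1 -> K) :
  op_coef (monic_op a) n.+1 = 1.
Proof. by rewrite op_coef_monic_op eqxx. Qed.

Lemma op_coef_monic_op_subtop (K : diffFieldType) n (a : 'I_n.+1 -> K) :
  op_coef (monic_op a) n = a ord_max.
Proof.
rewrite op_coef_monic_op (ltn_eqF (ltnSn n)).
by rewrite (insubT (fun i => i < n.+1)%N (ltnSn n)); congr (a _); apply/val_inj.
Qed.

(** Provides that 2 and n+1 are nonzero in C(z). *)
Lemma ratfun_natr_neq0 (F : numFieldType) m : (m.+1%:R : ratfun F) != 0.
Proof.
rewrite -[m.+1%:R](rmorph_nat (@FracField.tofrac {poly F})) tofrac_eq0.
by rewrite -polyC_natr polyC_eq0 pnatr_eq0.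
Qed.

Theorem proposition3p4 (R : realType) (n : nat) (a : 'I_n.+1 -> ratfun rat)
    (L_irr : irreducible_elt (monic_op a)) :
  let aC := fun i => ratfun_map (ratr : {rmorphism rat -> R[i]}) (a i) in
  let L := monic_op aC in
  (property_P n L <->
     exists2 alpha : ratfun R[i], alpha != 0 &
       L * alpha%:O = alpha%:O * dual_op L) /\
  (forall alpha : ratfun R[i], alpha != 0 ->
     L * alpha%:O = alpha%:O * dual_op L ->
     der alpha = - (2%:R / n.+1%:R) * aC ord_max * alpha).
Proof.
move=> aC L; have sizeL : op_size L = n.+2 := op_size_monic_op aC.
have monL : op_coef L n.+1 = 1 := op_coef_monic_op_top aC.
have subtopL : op_coef L n = aC ord_max := op_coef_monic_op_subtop aC.
split; first split.
- exact: property_P_self_dual sizeL monL.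
- case=> alpha alpha0.
  exact: self_dual_property_P sizeL monL _ (ratfun_natr_neq0 _ 1) alpha0.
move=> alpha _ /(self_dual_der sizeL monL (ratfun_natr_neq0 _ n)).
by rewrite subtopL.
Qed.
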